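(* Let $b\ge 2$ and let $n_1,\ldots,n_b$ be positive integers. If $\mathcal{S}(n_1,n_2,\ldots,n_b)$ is a starlike block graph on $n=1+\sum_{i=1}^b n_i$ vertices, then $$\rho(\mathcal{S}_{n,b}^1)\le \rho(\mathcal{S}(n_1,n_2,\ldots,n_b))\le \rho(\mathcal{S}_{n,b}^2).$$ Moreover, among starlike block graphs on $n$ vertices with $b$ blocks, the maximal graph $\mathcal{S}_{n,b}^2$ and the minimal graph $\mathcal{S}_{n,b}^1$ are unique up to isomorphism (that is, equality holds on the right only if the graph is isomorphic to $\mathcal{S}_{n,b}^2$, and on the left only if it is isomorphic to $\mathcal{S}_{n,b}^1$).
   Context: The starlike block graph $\mathcal{S}(n_1,\ldots,n_b)$ is the graph consisting of $b\ge 2$ blocks which are the complete graphs $K_{n_1+1},\ldots,K_{n_b+1}$ (each $n_i\ge 1$), all sharing exactly one common vertex, the central cut vertex. For a simple connected graph $G$ with vertices $v_1,\ldots,v_n$, the squared distance matrix is $\Delta(G)=[d(v_i,v_j)^2]$, where $d$ is the shortest-path distance, and $\rho(G)$ denotes the spectral radius of $\Delta(G)$. For fixed $n$ and $b$: $\mathcal{S}_{n,b}^1=\mathcal{S}(n-b,1,1,\ldots,1)$ with $b-1$ ones. Writing $n-1=\lfloor\frac{n-1}{b}\rfloor b+r$ with $0\le r<b$, the graph $\mathcal{S}_{n,b}^2=\mathcal{S}\left(\lceil\frac{n-1}{b}\rceil,\ldots,\lceil\frac{n-1}{b}\rceil,\lfloor\frac{n-1}{b}\rfloor,\ldots,\lfloor\frac{n-1}{b}\rfloor\right)$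 has $r$ entries equal to $\lceil\frac{n-1}{b}\rceil$ and $b-r$ entries equal to $\lfloor\frac{n-1}{b}\rfloor$. *)

(* Defs.v *)
From HB Require Import structures.
From mathcomp Require Import all_boot all_order all_algebra.
From mathcomp Require Import complex.

Set Implicit Arguments.
Unset Strict Implicit.
Unset Printing Implicit Defensive.

Import Order.TTheory GRing.Theory Num.Theory.
Local Open Scope ring_scope.

Record sgraph := SGraph {
  vertex :> finType;
  adj : rel vertex;
  adj_sym : symmetric adj;
  adj_irrefl : irreflexive adj
}.

Definition sg_connected (G : sgraph) : Prop :=
  forall x y : G, connect (@adj G) x y.

Definition sg_iso (G H : sgraph) : Prop :=
  exists2 f : G -> H, bijective f & forall x y : G, adj (f x) (f y) = adj x y.

Definition has_walk (G : sgraph) (x y : G) (k : nat) : bool :=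
  [exists p : k.-tuple G, path (@adj G) x p && (last x p == y)].

(* The least length of a walk from x to y.  A shortest walk has fewer than
   #|G| edges; the value is #|G| if x and y are not connected. *)
Definition gdist (G : sgraph) (x y : G) : nat :=
  find (has_walk x y) (iota 0 #|G|).

Definition sqdist_mx (R : pzSemiRingType) (G : sgraph) : 'M[R]_#|G| :=
  \matrix_(i, j) ((gdist (enum_val i) (enum_val j))%:R ^+ 2).

(* The complex eigenvalues, with algebraic multiplicity. *)
Definition spectrum (R : rcfType) (m : nat) (A : 'M[R]_m) : seq R[i] :=
  sval (closed_field_poly_normal (char_poly (map_mx (real_complex R) A))).

Definition spectral_radius (R : rcfType) (m : nat) (A : 'M[R]_m) : R :=
  \big[Num.max/0]_(z <- spectrum A) ComplexField.Normc.normc z.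

Definition rho (R : rcfType) (G : sgraph) : R :=
  spectral_radius (sqdist_mx R G).

Section Starlike.
Variables (b : nat) (ns : 'I_b -> nat).

(* None is the central cut vertex; Some (Tagged _ j) with tag i is the j-th of
   the ns i other vertices of the i-th block, which is complete on ns i + 1
   vertices. *)
Definition starlike_vertex : finType := option {i : 'I_b & 'I_(ns i)}.

Definition starlike_adj (x y : starlike_vertex) : bool :=
  (x != y) &&
  match x, y with
  | Some u, Some v => tag u == tag v
  | _, _ => true
  end.

Lemma starlike_adj_sym : symmetric starlike_adj.
Proof.
move=> x y; rewrite /starlike_adj eq_sym; congr andb.
by case: x y => [u|] [v|] //; rewrite eq_sym.
Qed.

Lemma starlike_adj_irrefl : irreflexive starlike_adj.
Proof. by move=> x; rewrite /starlike_adj eqxx. Qed.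

Definition starlike : sgraph := SGraph starlike_adj_sym starlike_adj_irrefl.

Lemma starlike_connected : sg_connected starlike.
Proof.
have to_center (x : starlike) : connect (@adj starlike) x None.
  by case: x => [u|]; [exact: connect1 | exact: connect0].
move=> x y; apply: connect_trans (to_center x) _.
by rewrite (sym_connect_sym (@adj_sym starlike)) to_center.
Qed.

Lemma card_starlike : #|starlike| = (1 + \sum_(i < b) ns i)%N.
Proof.
rewrite card_option card_tagged sumnE big_map big_enum /= add1n.
by congr _.+1; apply: eq_bigr => i _; rewrite card_ord.
Qed.

End Starlike.

Definition ceil_divn (m d : nat) : nat := (m + d.-1) %/ d.

Definition starlike_min (n b : nat) : sgraph :=
  starlike (fun i : 'I_b => if val i == 0%N then (n - b)%N else 1%N).

Definition starlike_max (n b : nat) : sgraph :=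
  starlike (fun i : 'I_b =>
    if (i < (n - 1) %% b)%N then ceil_divn (n - 1) b else ((n - 1) %/ b)%N).

(* Main.v *)
Require Import Defs.
From HB Require Import structures.
From mathcomp Require Import all_boot all_order all_algebra.
From mathcomp Require Import complex.
From mathcomp Require Import perm ring lra zify.

Set Implicit Arguments.
Unset Strict Implicit.
Unset Printing Implicit Defensive.

Import Order.TTheory GRing.Theory Num.Theory.
Local Open Scope ring_scope.
Import ComplexField.Normc.

(** Everything rests on one scalar equation for the spectral radius.  The
    squared distances in a starlike block graph are 0, 1 (same block, or one
    of the two vertices is the centre) and 4, so a vector equal to [x0] at the
    centre and to [x_i] on the other vertices of block [i] is an eigenvector
    for [l] exactly when
      [l x0 = S]   and   [l x_i = x0 + 4 S - 3 n_i x_i - x_i],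
    with [S = \sum_i n_i x_i].  Normalising [x0 + 4 S = 1], one finds
    [x_i = 1 / (l + 1 + 3 n_i)], hence [S = \sum_i n_i / (l + 1 + 3 n_i)], and
    what is left is the secular equation [(4 + 1/l) S = 1].  Its left side is
    positive and strictly decreasing in [l > 0], and a positive root exists by
    the intermediate value theorem.  The eigenvector attached to that root has
    positive entries, so by the easy half of Perron-Frobenius
    ([spectral_radius_pos_eigenvector]) the root is the spectral radius.

    The families with a fixed sum can therefore be compared at a fixed [l],
    through [S] alone: a larger [S] forces a larger root.  Now [S] is a sum of
    values of [t |-> t / (l + 1 + 3 t)], which is strictly concave.  Let [m] be
    a family with entries in [{p, q}].  Subtracting the chord of this function
    through [p] and [q] leaves a gap whose sign is that of
    [(t - p) (q - t)] ([chord_identity]); the chord is affine, so its sum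
    depends only on the number of blocks and the sum of the sizes, and
    [S(n) - S(m)] is the sum of the gaps at the [n_i] ([secular_sum_gap]).
    - For the lower bound take [p = 1] and [q = n - b], the smallest and
      largest possible sizes: all gaps are nonnegative.
    - For the upper bound take [p] the floor of [(n - 1) / b] and [q = p + 1]:
      no integer lies strictly between them, so all gaps are nonpositive.
    In both cases, equality of the radii makes every gap vanish, so that all
    [n_i] lie in [{p, q}]; the sum then determines how many of them equal [q],
    the two families agree up to a permutation of the blocks, and the graphs
    are isomorphic ([starlike_two_values_iso]). *)

(** * Spectral radius from a positive eigenvector *)

Lemma mem_spectrum (R : rcfType) (m : nat) (A : 'M[R]_m) (z : R[i]) :
  (z \in spectrum A) = eigenvalue (map_mx (real_complex R) A) z.
Proof.
rewrite eigenvalue_root_char /spectrum.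
case: closed_field_poly_normal => /= r defp.
rewrite [in RHS]defp (monicP (char_poly_monic _)) scale1r.
by rewrite root_prod_XsubC.
Qed.

Lemma normc_real_complex (R : rcfType) (x : R) :
  normc (real_complex R x) = `|x|.
Proof. by rewrite /normc /= expr0n /= addr0 sqrtr_sqr. Qed.

Lemma normc_ge0 (R : rcfType) (z : R[i]) : 0 <= normc z.
Proof. by case: z => a b; apply: sqrtr_ge0. Qed.

Lemma normc_sum (R : rcfType) (I : finType) (F : I -> R[i]) :
  normc (\sum_i F i) <= \sum_i normc (F i).
Proof.
elim/big_ind2: _ => [|a x c y le_xa le_yc|//]; first by rewrite normc0.
by apply: le_trans (lerD le_xa le_yc); apply: le_normcD.
Qed.

(** Given an eigenvector [v] for [z], compare [|v|] entrywise with the least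
    multiple [c x] that dominates it.  At an index [k] where the two meet,
    [|z| c x_k = |(v A)_k| <= c (x A)_k = l c x_k], so [|z| <= l]; and [l]
    itself is an eigenvalue. *)
Lemma spectral_radius_pos_eigenvector (R : rcfType) (m : nat) (A : 'M[R]_m)
    (x : 'rV[R]_m) (l : R) :
  (0 < m)%N -> (forall i j, 0 <= A i j) -> (forall i, 0 < x 0 i) -> 0 <= l ->
  x *m A = l *: x -> spectral_radius A = l.
Proof.
move=> m_gt0 A_ge0 x_gt0 l_ge0 xA; apply/eqP; rewrite eq_le; apply/andP; split.
  rewrite /spectral_radius big_seq; apply: bigmax_le => // z.
  rewrite mem_spectrum => /eigenvalueP[v vA v_neq0].
  have [i0 vi0] : exists i, v 0 i != 0.
    apply/existsP; apply: contraNT v_neq0; rewrite negb_exists => /forallP v0.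
    by apply/eqP/rowP=> i; rewrite mxE; apply/eqP; move: (v0 i); rewrite negbK.
  pose ratio i := normc (v 0 i) / x 0 i.
  have [k kmax] : exists k, forall i, ratio i <= ratio k.
    have [k _ kmax] := @Order.TotalTheory.arg_maxP _ _ _ i0 predT ratio isT.
    by exists k => i; apply: kmax.
  have ratio_ge0 i : 0 <= ratio i.
    by rewrite divr_ge0 ?(ltW (x_gt0 _)) // normc_ge0.
  have v_le i : normc (v 0 i) <= ratio k * x 0 i.
    by rewrite -ler_pdivrMr ?x_gt0 ?kmax.
  have ratio_k : normc (v 0 k) = ratio k * x 0 k.
    by rewrite divfK // gt_eqF.
  have ratio_gt0 : 0 < ratio k.
    apply: lt_le_trans (kmax i0); rewrite divr_gt0 // lt_def normc_ge0 andbT.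
    by apply: contraNneq vi0 => vi0; apply/eqP; exact: eq0_normc vi0.
  have zk : normc (\sum_j v 0 j * map_mx (real_complex R) A j k) =
      normc z * (ratio k * x 0 k).
    have := congr1 (fun w : 'rV_m => w 0 k) vA; rewrite /= !mxE => ->.
    by rewrite normcM ratio_k.
  have : normc z * (ratio k * x 0 k) <= l * (ratio k * x 0 k).
    rewrite -zk; apply: le_trans (normc_sum _) _.
    have := congr1 (fun w : 'rV_m => w 0 k) xA; rewrite /= !mxE => xAk.
    rewrite mulrCA -xAk mulr_sumr.
    apply: ler_sum => i _; rewrite mxE normcM normc_real_complex ger0_norm //.
    by rewrite mulrA ler_wpM2r.
  by rewrite ler_pM2r // mulr_gt0.
rewrite -[l in l <= _]ger0_norm // -normc_real_complex.
apply: (le_bigmax_seq _ _) => //; rewrite mem_spectrum; apply/eigenvalueP.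
exists (map_mx (real_complex R) x); first by rewrite -map_mxM xA map_mxZ.
have x0_gt0 := x_gt0 (Ordinal m_gt0).
apply: contraTneq x0_gt0 => /rowP/(_ (Ordinal m_gt0)).
by rewrite !mxE => -[->]; rewrite ltxx.
Qed.

(** * Distances and the eigenvector of a starlike block graph *)

Lemma iota_split3 n : (2 < n)%N ->
  iota 0 n = [:: 0, 1, 2 & iota 3 (n - 3)]%N.
Proof. by case: n => [|[|[|n]]] // _; rewrite !subSS subn0. Qed.

Lemma has_walk0 (G : sgraph) (x y : G) : has_walk x y 0 = (x == y).
Proof.
apply/existsP/eqP => [[p]|->]; first by rewrite tuple0 /= => /eqP.
by exists [tuple]; rewrite /= eqxx.
Qed.

Lemma has_walk1 (G : sgraph) (x y : G) : has_walk x y 1 = adj x y.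
Proof.
apply/existsP/idP => [[p]|xy]; last by exists [tuple y]; rewrite /= xy eqxx.
by case/tupleP: p => z p; rewrite tuple0 /= andbT => /andP[xz /eqP<-].
Qed.

Lemma has_walk2 (G : sgraph) (x z y : G) : adj x z -> adj z y -> has_walk x y 2.
Proof.
by move=> xz zy; apply/existsP; exists [tuple z; y]; rewrite /= xz zy eqxx.
Qed.

(** Two vertices of different blocks are joined by a walk of length 2 through
    the centre.  The bound on the number of vertices makes the range of
    lengths searched by [gdist] reach 2. *)
Lemma gdist_starlike (b : nat) (ns : 'I_b -> nat) (x y : starlike ns) :
  (2 < #|starlike ns|)%N ->
  gdist x y = if x == y then 0%N else if adj x y then 1%N else 2.
Proof.
move=> card3; rewrite /gdist iota_split3 //; case: eqVneq => [->|xy].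
  by rewrite /= has_walk0 eqxx.
case: ifPn => [xy1|nxy]; first by rewrite /= has_walk0 has_walk1 (negPf xy) xy1.
have [xc cy] : adj x (None : starlike ns) /\ adj (None : starlike ns) y.
  by move: xy nxy; case: x y => [u|] [v|].
by rewrite /= has_walk0 has_walk1 (negPf xy) (negPf nxy) (has_walk2 xc cy).
Qed.

(** The total weight [\sum_i n_i x_i] of the non-central vertices in the
    eigenvector for [l], normalised so that [x_i = 1 / (l + 1 + 3 n_i)]. *)
Definition secular_sum (R : fieldType) b (ns : 'I_b -> nat) (l : R) : R :=
  \sum_i (ns i)%:R / (l + 1 + 3 * (ns i)%:R).

Lemma sum_option (R : nmodType) (T : finType) (F : option T -> R) :
  \sum_x F x = F None + \sum_u F (Some u).
Proof.
rewrite (bigD1 None) //=; congr (_ + _).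
rewrite (reindex_omap (@Some T) id) /=; last by case.
by apply: eq_bigl => u; rewrite eqxx.
Qed.

Lemma sum_tagged (R : pzSemiRingType) b (ns : 'I_b -> nat) (F : 'I_b -> R) :
  \sum_(u : {i & 'I_(ns i)}) F (tag u) = \sum_i (ns i)%:R * F i.
Proof.
under [RHS]eq_bigr => i _ do rewrite mulr_natl.
transitivity (\sum_i \sum_(j < ns i) F i); first by rewrite sig_big_dep.
by apply: eq_bigr => i _; rewrite sumr_const card_ord.
Qed.

(** For the row of a non-central vertex [v], the squared distance to another
    non-central [u] is [4 - 3 [same block] - [u = v]]; each of the three terms
    sums to something explicit. *)
Lemma starlike_eigenvector (R : realFieldType) b (ns : 'I_b -> nat) (l : R) :
  (2 < #|starlike ns|)%N -> 0 < l -> l = (4 * l + 1) * secular_sum ns l ->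
  let w (x : starlike ns) :=
    if x is Some u then (l + 1 + 3 * (ns (tag u))%:R)^-1
    else secular_sum ns l / l in
  forall y, \sum_x w x * (gdist x y)%:R ^+ 2 = l * w y.
Proof.
move=> card3 l_gt0 lE w y.
have c_gt0 i : 0 < l + 1 + 3 * (ns i)%:R by have := ler0n R (ns i); lra.
have wS : \sum_u w (Some u) = secular_sum ns l.
  by rewrite /w (sum_tagged ns (fun i => (l + 1 + 3 * (ns i)%:R)^-1)).
rewrite sum_option; case: y => [v|]; last first.
  rewrite gdist_starlike //= expr0n mulr0 add0r /w mulrCA divff ?gt_eqF //.
  rewrite mulr1 -wS; apply: eq_bigr => u _.
  by rewrite gdist_starlike //= expr1n mulr1.
have -> : \sum_u w (Some u) * (gdist (Some u : starlike ns) (Some v))%:R ^+ 2 =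
    \sum_u (4 * w (Some u) - 3 * (w (Some u) * (tag u == tag v)%:R)
      - w (Some u) * (u == v)%:R).
  apply: eq_bigr => u _; rewrite gdist_starlike // /adj /= /starlike_adj /=.
  rewrite -[Some u == Some v]/(u == v).
  case: (eqVneq u v) => [->|_]; first by rewrite eqxx /=; ring.
  by case: eqVneq => _ /=; ring.
rewrite gdist_starlike //= !sumrB -!mulr_sumr wS.
have -> : \sum_u w (Some u) * (u == v)%:R = w (Some v).
  rewrite (bigD1 v) //= eqxx mulr1 big1 ?addr0 // => u /negPf->.
  by rewrite mulr0.
have -> : \sum_u w (Some u) * (tag u == tag v)%:R =
    (ns (tag v))%:R * w (Some v).
  pose F i := (l + 1 + 3 * (ns i)%:R)^-1 * (i == tag v)%:R.
  rewrite /w (sum_tagged ns F) /F.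
  rewrite (bigD1 (tag v)) //= eqxx mulr1 big1 ?addr0 // => i /negPf->.
  by rewrite !mulr0.
rewrite /= /w; have := c_gt0 (tag v); set k := (ns _)%:R => c.
have -> : secular_sum ns l = l / (4 * l + 1).
  by rewrite [in X in _ = X / _]lE mulrC mulKf // gt_eqF //; lra.
field; rewrite !gt_eqF //=; lra.
Qed.

(** * The secular equation *)

Lemma card_starlike_gt2 b (ns : 'I_b -> nat) :
  (2 <= b)%N -> (forall i, (0 < ns i)%N) -> (2 < #|starlike ns|)%N.
Proof.
move=> b2 ns_gt0; rewrite card_starlike ltnS; apply: leq_trans b2 _.
rewrite -[b in (b <= _)%N]card_ord -sum1_card.
by apply: leq_sum => i _; apply: ns_gt0.
Qed.

Section SecularEquation.
Variables (R : realFieldType) (b : nat) (ns : 'I_b -> nat).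
Hypotheses (b2 : (2 <= b)%N) (ns_gt0 : forall i, (0 < ns i)%N).

Lemma secular_den_gt0 (l : R) k : 0 <= l -> 0 < l + 1 + 3 * k%:R.
Proof. by have := ler0n R k; lra. Qed.

Lemma secular_sum_gt0 (l : R) : 0 <= l -> 0 < secular_sum ns l.
Proof.
move=> l_ge0; have b_gt0 : (0 < b)%N by apply: ltn_trans b2.
rewrite /secular_sum (bigD1 (Ordinal b_gt0)) //=.
apply: ltr_wpDr; last by rewrite divr_gt0 ?ltr0n ?secular_den_gt0.
by apply: sumr_ge0 => i _; rewrite divr_ge0 ?ler0n // ltW // secular_den_gt0.
Qed.

Lemma secular_sum_anti (l m : R) :
  0 <= l -> l <= m -> secular_sum ns m <= secular_sum ns l.
Proof.
move=> l_ge0 lm; apply: ler_sum => i _; rewrite ler_wpM2l ?ler0n //.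
have m_ge0 := le_trans l_ge0 lm.
by rewrite lef_pV2 ?posrE ?secular_den_gt0 // !lerD2r.
Qed.

(** The equation [secular l = 1] is the eigenvalue equation at the centre,
    [l x0 = S], with [x0] eliminated through [x0 + 4 S = 1]. *)
Definition secular (l : R) : R := (4 + l^-1) * secular_sum ns l.

Lemma secular_decr (l m : R) : 0 < l -> l < m -> secular m < secular l.
Proof.
move=> l_gt0 lm; have m_gt0 := lt_trans l_gt0 lm; rewrite /secular.
apply: (@le_lt_trans _ _ ((4 + m^-1) * secular_sum ns l)).
  by rewrite ler_wpM2l ?secular_sum_anti // ?addr_ge0 ?invr_ge0 // ltW.
by rewrite ltr_pM2r ?secular_sum_gt0 ?ltW // ltrD2l ltf_pV2.
Qed.
End SecularEquation.

(** The equation [l = (4 l + 1) S(l)] with denominators cleared, so that the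
    intermediate value theorem for polynomials applies over any real closed
    field. *)
Definition secular_poly (R : fieldType) b (ns : 'I_b -> nat) : {poly R} :=
  let c i := 'X + (1 + 3 * (ns i)%:R)%:P in
  'X * (\prod_i c i)
    - (4 *: 'X + 1) * \sum_i (ns i)%:R%:P * \prod_(j | j != i) c j.

Lemma horner_secular_poly (R : realFieldType) b (ns : 'I_b -> nat) (l : R) :
  0 <= l ->
  (secular_poly R ns).[l] =
    (\prod_i (l + 1 + 3 * (ns i)%:R)) * (l - (4 * l + 1) * secular_sum ns l).
Proof.
move=> l_ge0.
have cE i : ('X + (1 + 3 * (ns i)%:R)%:P).[l] = l + 1 + 3 * (ns i)%:R.
  by rewrite hornerD hornerX hornerC addrA.
rewrite /secular_poly !(hornerE, horner_prod, horner_sum) mulrBr.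
rewrite [in RHS]mulrCA; congr (_ - _ * _).
  by rewrite mulrC; congr (_ * _); apply: eq_bigr.
rewrite /secular_sum mulr_sumr; apply: eq_bigr => i _.
rewrite !hornerE horner_prod [in RHS](bigD1 i) //= [in RHS]mulrC mulrA.
rewrite mulKf ?gt_eqF ?secular_den_gt0 // [in RHS]mulrC.
by congr (_ * _); apply: eq_bigr.
Qed.

Lemma secular_root (R : rcfType) b (ns : 'I_b -> nat) :
  (2 <= b)%N -> (forall i, (0 < ns i)%N) ->
  exists2 l : R, 0 < l & secular ns l = 1.
Proof.
move=> b2 ns_gt0; pose N : R := \sum_i (ns i)%:R.
have N_ge0 : 0 <= N by apply: sumr_ge0.
have D_gt0 (l : R) : 0 <= l -> 0 < \prod_i (l + 1 + 3 * (ns i)%:R).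
  by move=> l_ge0; apply: prodr_gt0 => i _; apply: secular_den_gt0.
have L_ge0 : 0 <= 4 * N by rewrite mulr_ge0.
have [] := @poly_ivt R (secular_poly R ns) 0 (4 * N) L_ge0.
  rewrite !horner_secular_poly //; apply/andP; split.
    apply: mulr_ge0_le0; first by rewrite ltW ?D_gt0.
    by have := secular_sum_gt0 b2 ns_gt0 (lexx (0 : R)); lra.
  apply: mulr_ge0; first by rewrite ltW // D_gt0.
  (* Dropping 3 n_i from the denominators gives S(l) <= N / (l + 1), and this
     is already small enough for (4 l + 1) S(l) <= l at l = 4 N. *)
  have : secular_sum ns (4 * N) <= N / (4 * N + 1).
    rewrite mulr_suml; apply: ler_sum => i _; rewrite ler_wpM2l //.
    rewrite lef_pV2 ?posrE ?secular_den_gt0 ?mulr_ge0 //; last lra.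
    by have := ler0n R (ns i); lra.
  set S := secular_sum _ _; rewrite ler_pdivlMr; last lra.
  nra.
move=> l /andP[l_ge0 _]; rewrite /root horner_secular_poly // mulf_eq0.
rewrite gt_eqF ?D_gt0 //= subr_eq0 => /eqP lE.
have l_gt0 : 0 < l.
  rewrite lt_def l_ge0 andbT; apply/eqP => l0.
  by have := secular_sum_gt0 b2 ns_gt0 l_ge0; move: lE; rewrite l0; lra.
exists l => //; apply: (mulfI (lt0r_neq0 l_gt0)).
by rewrite mulr1 [in RHS]lE mulrA mulrDr mulfV ?lt0r_neq0 // [l * 4]mulrC.
Qed.

Lemma rho_starlike (R : rcfType) b (ns : 'I_b -> nat) (l : R) :
  (2 <= b)%N -> (forall i, (0 < ns i)%N) -> 0 < l -> secular ns l = 1 ->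
  rho R (starlike ns) = l.
Proof.
move=> b2 ns_gt0 l_gt0 secl; have card3 := card_starlike_gt2 b2 ns_gt0.
have lE : l = (4 * l + 1) * secular_sum ns l.
  rewrite -[LHS]mulr1 -[X in l * X]secl /secular mulrA mulrDr mulfV ?gt_eqF //.
  by rewrite [l * 4]mulrC.
have := starlike_eigenvector card3 l_gt0 lE; set w := fun x => _ => /= wE.
have S_gt0 := secular_sum_gt0 b2 ns_gt0 (ltW l_gt0).
apply: (@spectral_radius_pos_eigenvector _ _ _ (\row_i w (enum_val i))).
- by apply: leq_trans card3.
- by move=> i j; rewrite mxE exprn_ge0.
- move=> i; rewrite mxE /w; case: (enum_val i) => [u|].
    by rewrite invr_gt0 secular_den_gt0 // ltW.
  by rewrite divr_gt0.
- exact: ltW.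
apply/rowP=> j; rewrite !mxE -wE.
rewrite (big_enum_val (fun x => w x * (gdist x (enum_val j))%:R ^+ 2)).
by apply: eq_bigr => i _; rewrite !mxE.
Qed.

Lemma rho_secular (R : rcfType) b (ns : 'I_b -> nat) :
  (2 <= b)%N -> (forall i, (0 < ns i)%N) ->
  0 < rho R (starlike ns) /\ secular ns (rho R (starlike ns)) = 1.
Proof.
move=> b2 ns_gt0; have [l l_gt0 secl] := secular_root R b2 ns_gt0.
by rewrite (rho_starlike b2 ns_gt0 l_gt0 secl).
Qed.

(** Were the roots in the opposite order, strict decrease would put the
    secular function of [ms] below 1 at the root of [ns], where it is at
    least 1. *)
Lemma rho_le (R : rcfType) b (ns ms : 'I_b -> nat) :
  (2 <= b)%N -> (forall i, (0 < ns i)%N) -> (forall i, (0 < ms i)%N) ->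
  (forall l : R, 0 < l -> secular_sum ns l <= secular_sum ms l) ->
  rho R (starlike ns) <= rho R (starlike ms).
Proof.
move=> b2 ns_gt0 ms_gt0 le_nm.
have [ln_gt0 secn] := rho_secular R b2 ns_gt0.
have [lm_gt0 secm] := rho_secular R b2 ms_gt0.
rewrite leNgt; apply/negP => lt_mn.
have := secular_decr b2 ms_gt0 lm_gt0 lt_mn; rewrite secm -secn ltNge.
by rewrite ler_wpM2l ?le_nm // addr_ge0 // invr_ge0 ltW.
Qed.

(** At the common root the two secular functions both equal 1. *)
Lemma rho_eq_secular_sum (R : rcfType) b (ns ms : 'I_b -> nat) :
  (2 <= b)%N -> (forall i, (0 < ns i)%N) -> (forall i, (0 < ms i)%N) ->
  rho R (starlike ns) = rho R (starlike ms) ->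
  exists2 l : R, 0 < l & secular_sum ns l = secular_sum ms l.
Proof.
move=> b2 ns_gt0 ms_gt0 eq_rho.
have [l_gt0 secn] := rho_secular R b2 ns_gt0.
have [_ secm] := rho_secular R b2 ms_gt0.
exists (rho R (starlike ns)) => //; rewrite -eq_rho -secn in secm.
apply/esym; apply: mulfI secm; rewrite gt_eqF //.
by rewrite ltr_pwDl // invr_ge0 ltW.
Qed.

(** * Comparison with a chord *)

(** The height of the graph of [t |-> t / (l + 1 + 3 t)] above its chord through
    [p] and [q], in a factored form that shows its sign. *)
Definition chord_gap (R : fieldType) (l : R) (p q t : nat) : R :=
  3 * (l + 1) * ((t%:R - p%:R) * (q%:R - t%:R)) /
  ((l + 1 + 3 * p%:R) * (l + 1 + 3 * t%:R) * (l + 1 + 3 * q%:R)).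

Lemma chord_identity (R : realFieldType) (l : R) (p q t : nat) : 0 <= l ->
  t%:R / (l + 1 + 3 * t%:R) =
  p%:R / (l + 1 + 3 * p%:R)
  + (t%:R - p%:R) * ((l + 1) / ((l + 1 + 3 * p%:R) * (l + 1 + 3 * q%:R)))
  + chord_gap l p q t.
Proof.
by move=> l_ge0; rewrite /chord_gap; field; rewrite !gt_eqF ?secular_den_gt0.
Qed.

Lemma chord_gap_eq0 (R : realFieldType) (l : R) (p q t : nat) : 0 <= l ->
  (chord_gap l p q t == 0) = (t == p) || (t == q).
Proof.
move=> l_ge0; rewrite /chord_gap mulf_eq0 invr_eq0 !mulf_eq0 !subr_eq0 !eqr_nat.
rewrite !(gt_eqF (secular_den_gt0 _ l_ge0)) (gt_eqF (_ : 0 < l + 1)); last lra.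
by rewrite pnatr_eq0 [q == t]eq_sym; apply: orbF.
Qed.

Lemma chord_gap_ge0 (R : realFieldType) (l : R) (p q t : nat) :
  0 <= l -> (p <= t <= q)%N -> 0 <= chord_gap l p q t.
Proof.
move=> l_ge0 /andP[pt tq]; have d := secular_den_gt0 _ l_ge0.
apply: divr_ge0; last by rewrite !mulr_ge0 // ltW.
by rewrite !mulr_ge0 ?subr_ge0 ?ler_nat //; lra.
Qed.

Lemma chord_gap_le0 (R : realFieldType) (l : R) (p t : nat) :
  0 <= l -> chord_gap l p p.+1 t <= 0.
Proof.
move=> l_ge0; have d := secular_den_gt0 _ l_ge0.
apply: mulr_le0_ge0; last by rewrite invr_ge0 !mulr_ge0 // ltW.
apply: mulr_ge0_le0; first by rewrite mulr_ge0 //; lra.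
case: (leqP t p) => tp.
  by rewrite mulr_le0_ge0 ?subr_le0 ?subr_ge0 ?ler_nat // leqW.
by rewrite mulr_ge0_le0 ?subr_le0 ?subr_ge0 ?ler_nat // ltnW.
Qed.

(** Summing [chord_identity], the affine parts cancel because both families
    have [b] entries and the same sum, and the gaps of [ms] are zero. *)
Lemma secular_sum_gap (R : realFieldType) b (ns ms : 'I_b -> nat)
    (p q : nat) (l : R) :
  0 <= l -> (forall i, (ms i == p) || (ms i == q)) ->
  (\sum_i ns i = \sum_i ms i)%N ->
  secular_sum ns l = secular_sum ms l + \sum_i chord_gap l p q (ns i).
Proof.
move=> l_ge0 ms_pq eq_sum; rewrite /secular_sum.
under eq_bigr => i _ do rewrite (chord_identity p q _ l_ge0).
under [in RHS]eq_bigr => i _ do rewrite (chord_identity p q _ l_ge0).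
rewrite !big_split /= -!mulr_suml !sumrB -!natr_sum eq_sum.
rewrite [X in _ = _ + X + _]big1 ?addr0 // => i _.
by apply/eqP; rewrite chord_gap_eq0.
Qed.

(** * Isomorphisms *)

(** The sum of a list with entries in [{p, q}] is [p] times its length plus
    [q - p] times the number of [q]s; for [p < q] it determines that number. *)
Lemma perm_eq_two_values (s t : seq nat) (p q : nat) : (p <= q)%N ->
  all (pred2 p q) s -> all (pred2 p q) t ->
  size s = size t -> sumn s = sumn t -> perm_eq s t.
Proof.
move=> le_pq; have dec (r : seq nat) : all (pred2 p q) r ->
    perm_eq r (nseq (count_mem q r) q ++ nseq (size r - count_mem q r) p)
    /\ sumn r = (p * size r + (q - p) * count_mem q r)%N.
  move=> rpq; have rE :
      perm_eq r (nseq (count_mem q r) q ++ nseq (size r - count_mem q r) p).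
    rewrite -(perm_filterC (pred1 q) r).
    have -> : [seq x <- r | pred1 q x] = nseq (count_mem q r) q.
      by rewrite -size_filter; apply/all_pred1P/filter_all.
    have -> : (size r - count_mem q r)%N = count (predC (pred1 q)) r.
      by rewrite -(count_predC (pred1 q) r) addKn.
    suff -> : [seq x <- r | predC (pred1 q) x] =
        nseq (count (predC (pred1 q)) r) p by [].
    rewrite -size_filter; apply/all_pred1P; apply/allP => x.
    rewrite mem_filter /= => /andP[xq /(allP rpq)] /=.
    by rewrite (negPf xq) orbF.
  split=> //; rewrite (perm_sumn rE) sumn_cat !sumn_nseq.
  move: (count_size (pred1 q) r); move: (count_mem q r) => c /subnKC <-.
  rewrite -{1}(subnKC le_pq) addKn; ring.
move=> /dec[sE sumE] /dec[tE sumE'] eq_size eq_sum.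
have [pq|ne_pq] := eqVneq p q.
  subst q; move: sE tE; rewrite -!nseqD !subnKC ?count_size // eq_size => sE tE.
  by rewrite (perm_trans sE) // perm_sym.
have eq_count : count_mem q s = count_mem q t.
  by move: sumE; rewrite eq_sum sumE' eq_size; nia.
by rewrite (perm_trans sE) // perm_sym (perm_trans tE) // eq_count eq_size.
Qed.

Lemma starlike_perm_iso b (ns ms : 'I_b -> nat) (s : {perm 'I_b}) :
  (forall i, ns i = ms (s i)) -> sg_iso (starlike ns) (starlike ms).
Proof.
move=> ns_ms.
pose f (x : starlike ns) : starlike ms :=
  omap (fun u => Tagged (fun i => 'I_(ms i))
                   (cast_ord (ns_ms (tag u)) (tagged u))) x.
have f_inj : injective f.
  case=> [[i j]|] [[i' j']|] // /Some_inj/eqP; rewrite -tag_eqE /tag_eq /=.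
  case/andP=> /eqP/perm_inj eq_i; subst i'.
  rewrite tagged_asE => /eqP/(congr1 val) /= eq_j.
  by congr (Some (Tagged _ _)); apply: val_inj.
exists f.
  apply: inj_card_bij f_inj _; rewrite !card_starlike leq_add2l.
  rewrite (reindex_inj (@perm_inj _ s)) /=.
  by apply: leq_sum => i _; rewrite -ns_ms.
move=> x y; rewrite /adj /= /starlike_adj (inj_eq f_inj); congr andb.
by case: x y => [u|] [v|] //=; rewrite (inj_eq perm_inj).
Qed.

Lemma starlike_two_values_iso b (ns ms : 'I_b -> nat) (p q : nat) :
  (p <= q)%N ->
  (forall i, (ns i == p) || (ns i == q)) ->
  (forall i, (ms i == p) || (ms i == q)) ->
  (\sum_i ns i = \sum_i ms i)%N -> sg_iso (starlike ns) (starlike ms).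
Proof.
move=> le_pq ns_pq ms_pq eq_sum.
have /tuple_permP[s sE] : perm_eq (mktuple ns) (mktuple ms).
  apply: (perm_eq_two_values le_pq); rewrite ?size_tuple //.
  - by apply/allP => _ /codomP[i ->]; apply: ns_pq.
  - by apply/allP => _ /codomP[i ->]; apply: ms_pq.
  rewrite !sumnE !big_tuple; under eq_bigr do rewrite tnth_mktuple.
  by under [in RHS]eq_bigr do rewrite tnth_mktuple.
apply: (@starlike_perm_iso _ _ _ s) => i.
have /val_inj/(congr1 (fun t => tnth t i)) := sE.
by rewrite !tnth_mktuple.
Qed.

(** * The extremal families *)

Lemma sum_starlike_min b n : (0 < b)%N -> (b < n)%N ->
  (\sum_(i < b) (if val i == 0 then n - b else 1) = n - 1)%N.
Proof.
case: b => // b _ lt_bn; rewrite big_ord_recl /= sum_nat_const card_ord; lia.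
Qed.

Lemma ceil_divnE m d :
  (0 < d)%N -> (0 < m %% d)%N -> ceil_divn m d = (m %/ d).+1.
Proof.
move=> d_gt0 r_gt0; have r_lt := ltn_pmod m d_gt0.
rewrite /ceil_divn {1}(divn_eq m d).
have -> : (m %/ d * d + m %% d + d.-1 = (m %/ d).+1 * d + (m %% d).-1)%N.
  by rewrite mulSn; lia.
by rewrite divnMDl // (divn_small (_ : (m %% d).-1 < d)%N) ?addn0 //; lia.
Qed.

Lemma starlike_max_blockE b m i : (0 < b)%N ->
  (if (i < m %% b)%N then ceil_divn m b else (m %/ b)%N)
    = (m %/ b + (i < m %% b))%N.
Proof.
move=> b_gt0; case: ifPn => [lt_i|_]; last by rewrite addn0.
by rewrite ceil_divnE ?addn1 // (leq_ltn_trans _ lt_i).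
Qed.

Lemma sum_starlike_max b m : (0 < b)%N ->
  (\sum_(i < b) (m %/ b + (i < m %% b)) = m)%N.
Proof.
move=> b_gt0; rewrite [RHS](divn_eq _ b).
rewrite big_split /= sum_nat_const card_ord mulnC; congr addn.
rewrite -big_mkcond /= -(big_ord_widen _ (fun=> 1%N)) ?sum1_card ?card_ord //.
by rewrite ltnW // ltn_mod.
Qed.

Section TwoValues.
Variables (R : rcfType) (b : nat) (ns ms : 'I_b -> nat) (p q : nat).
Hypotheses (b2 : (2 <= b)%N) (le_pq : (p <= q)%N).
Hypotheses (ns_gt0 : forall i, (0 < ns i)%N) (ms_gt0 : forall i, (0 < ms i)%N).
Hypothesis ms_pq : forall i, (ms i == p) || (ms i == q).
Hypothesis eq_sum : (\sum_i ns i = \sum_i ms i)%N.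

Let gap_sum (l : R) (l_gt0 : 0 < l) :
  secular_sum ns l = secular_sum ms l + \sum_i chord_gap l p q (ns i).
Proof. exact: secular_sum_gap (ltW l_gt0) ms_pq eq_sum. Qed.

Lemma rho_two_values_min :
  (forall i, (p <= ns i <= q)%N) ->
  rho R (starlike ms) <= rho R (starlike ns).
Proof.
move=> ns_pq; apply: rho_le => // l l_gt0; rewrite gap_sum // lerDl.
by apply: sumr_ge0 => i _; apply: chord_gap_ge0 (ltW l_gt0) _.
Qed.

Lemma rho_two_values_max : q = p.+1 ->
  rho R (starlike ns) <= rho R (starlike ms).
Proof.
move=> qE; apply: rho_le => // l l_gt0; rewrite gap_sum // gerDl qE.
by apply: sumr_le0 => i _; apply: chord_gap_le0 (ltW l_gt0).
Qed.

(** Under either hypothesis the gaps have a constant sign, so equality of the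
    radii, which makes them sum to zero at the common root, makes each of them
    zero. *)
Lemma rho_two_values_iso :
  (forall i, (p <= ns i <= q)%N) \/ q = p.+1 ->
  rho R (starlike ns) = rho R (starlike ms) ->
  sg_iso (starlike ns) (starlike ms).
Proof.
move=> gap_sign /(rho_eq_secular_sum b2 ns_gt0 ms_gt0)[l l_gt0].
have l_ge0 := ltW l_gt0.
rewrite gap_sum // => /(canRL (addKr _)); rewrite addNr => gap0.
apply: (starlike_two_values_iso le_pq _ ms_pq eq_sum) => i.
rewrite -(chord_gap_eq0 _ _ _ l_ge0); apply/eqP.
case: gap_sign => [ns_pq|qE].
  by apply: (psumr_eq0P _ gap0) => // j _; apply: chord_gap_ge0.
apply: oppr_inj; rewrite oppr0.
apply: (@psumr_eq0P _ _ predT (fun j => - chord_gap l p q (ns j))) => //.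
  by move=> j _; rewrite oppr_ge0 qE chord_gap_le0.
by rewrite sumrN gap0 oppr0.
Qed.
End TwoValues.

(** Each of the other [b - 1] blocks uses up at least one non-central vertex. *)
Lemma starlike_block_le b (ns : 'I_b -> nat) i :
  (forall j, (0 < ns j)%N) -> (ns i + b <= (\sum_j ns j).+1)%N.
Proof.
move=> ns_gt0; rewrite (bigD1 i) //= -addnS leq_add2l.
apply: (@leq_trans (\sum_(j | j != i) 1).+1); last first.
  by rewrite ltnS; apply: leq_sum => j _; apply: ns_gt0.
by rewrite sum1_card [#|_|](cardC1 i) card_ord leqSpred.
Qed.

Theorem theorem4p4 (R : rcfType) (b n : nat) (ns : 'I_b -> nat)
    (hb : (2 <= b)%N) (hns : forall i, (0 < ns i)%N)
    (hn : n = (1 + \sum_(i < b) ns i)%N) :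
  [/\ rho R (starlike_min n b) <= rho R (starlike ns),
      rho R (starlike ns) <= rho R (starlike_max n b),
      rho R (starlike ns) = rho R (starlike_max n b) ->
        sg_iso (starlike ns) (starlike_max n b)
    & rho R (starlike ns) = rho R (starlike_min n b) ->
        sg_iso (starlike ns) (starlike_min n b)].
Proof.
have b_gt0 : (0 < b)%N by apply: ltnW.
have ns_le i : (ns i <= n - b)%N.
  by have := starlike_block_le i hns; rewrite -add1n -hn; lia.
have n_gtb : (b < n)%N.
  by have := ns_le (Ordinal b_gt0); have := hns (Ordinal b_gt0); lia.
have sum_ns : (\sum_i ns i = n - 1)%N by rewrite hn addKn.
rewrite /starlike_min /starlike_max; set mn := fun i => _; set mx := fun i => _.
have mn_gt0 i : (0 < mn i)%N.
  by rewrite /mn; case: ifP => // _; rewrite subn_gt0.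
have mn_pq i : (mn i == 1%N) || (mn i == n - b)%N.
  by rewrite /mn; case: ifP => _; rewrite eqxx ?orbT.
have sum_mn : (\sum_i ns i = \sum_i mn i)%N by rewrite sum_ns sum_starlike_min.
have ns_in i : (1 <= ns i <= n - b)%N by rewrite hns ns_le.
have le_1nb : (1 <= n - b)%N by rewrite subn_gt0.
have q_gt0 : (0 < (n - 1) %/ b)%N by rewrite divn_gt0 //; lia.
have mxE i : mx i = ((n - 1) %/ b + (i < (n - 1) %% b))%N.
  exact: starlike_max_blockE.
have mx_gt0 i : (0 < mx i)%N by rewrite mxE addn_gt0 q_gt0.
have mx_pq i : (mx i == (n - 1) %/ b)%N || (mx i == ((n - 1) %/ b).+1).
  by rewrite mxE; case: (i < _)%N; rewrite ?addn1 ?addn0 eqxx ?orbT.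
have sum_mx : (\sum_i ns i = \sum_i mx i)%N.
  by rewrite sum_ns (eq_bigr _ (fun i _ => mxE i)) sum_starlike_max.
split.
- exact: rho_two_values_min mn_pq sum_mn ns_in.
- exact: rho_two_values_max mx_pq sum_mx erefl.
- apply: (rho_two_values_iso hb (leqnSn _) hns mx_gt0 mx_pq sum_mx).
  by right.
- apply: (rho_two_values_iso hb le_1nb hns mn_gt0 mn_pq sum_mn).
  by left.
Qed.
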